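(* Let $k$ be a field, $G$ a group, $\gamma\in G$, $\chi\colon G\to k^\times$ a group homomorphism, and $c\in Z^1(G,k_\chi)$. Let $\sigma$ be the $k$-algebra automorphism of $kG$ with $\sigma(\tau)=\chi(\tau)\gamma\tau\gamma^{-1}$, let $\delta_c$ be the $k$-linear $\sigma$-derivation with $\delta_c(\tau)=c(\tau)\gamma\tau$ ($\tau\in G$), and let $A=kG[t;\sigma,\delta_c]$ be $G$-graded with $\deg t=\gamma$. If $G$ is finite, then $A$ is not gr-simple. In particular, let $\operatorname{char}k=p>0$, $G=C_p=\langle g\rangle$ the cyclic group of order $p$, $\chi=1$ and $c(g^i)=i\cdot1_k$. Then $[c]\neq0$ in $H^1(G,k)$, but $A(s^p-s)$, with $s=\gamma^{-1}t$, is a nonzero proper graded ideal of $A$.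
   Context: $Z^1(G,k_\chi)$ is the $k$-space of maps $c\colon G\to k$ with $c(\tau\rho)=c(\tau)+\chi(\tau)c(\rho)$; $B^1(G,k_\chi)$ is the subspace of maps $\tau\mapsto x(\chi(\tau)-1)$ with $x\in k$; $H^1(G,k_\chi)=Z^1/B^1$, $[c]$ is the class of $c$, and $H^1(G,k)$ is the case $\chi=1$. $kG$ is $G$-graded by $(kG)_\tau=k\tau$. For a ring endomorphism $\sigma$ of $R$, a $\sigma$-derivation is an additive map $\delta$ with $\delta(rs)=\delta(r)s+\sigma(r)\delta(s)$; the Ore extension $R[t;\sigma,\delta]$ is the free left $R$-module with basis $1,t,t^2,\dots$ with multiplication determined by $tr=\sigma(r)t+\delta(r)$. The $G$-grading on $A$ is $A_\alpha=\bigoplus_{n\ge0}(kG)_{\alpha\gamma^{-n}}t^n$ ($\alpha\in G$). An ideal (two-sided) is graded if generated by homogeneous elements; a graded ring is gr-simple if $0$ and the ring itself are its only graded ideals. *)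

(* Defs.v *)
From HB Require Import structures.
From mathcomp Require Import all_boot all_algebra all_fingroup.
From mathcomp Require Import generic_quotient ring_quotient boolp.

Set Implicit Arguments.
Unset Strict Implicit.
Unset Printing Implicit Defensive.

Import GRing.Theory.
Local Open Scope ring_scope.
Local Open Scope quotient_scope.

(* The library instance on {ffun G -> k} is the pointwise product; the alias
   carries the convolution product instead. *)
Definition galg (k : fieldType) (G : finGroupType) := {ffun G -> k^o}.

Section GroupAlgebra.
Variables (k : fieldType) (G : finGroupType).
Local Notation kG := (galg k G).

HB.instance Definition _ := GRing.Lmodule.on kG.

Definition gelt (tau : G) : kG := [ffun rho => (rho == tau)%:R].

Definition lin_ext (V : lmodType k) (f : G -> V) (r : kG) : V :=
  \sum_tau r tau *: f tau.

Definition galg_mul (r s : kG) : kG :=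
  lin_ext (fun tau => lin_ext (fun rho => gelt (tau * rho)%g) s) r.

Fact lin_ext_is_linear (V : lmodType k) (f : G -> V) : linear (lin_ext f).
Proof.
move=> a r s; rewrite /lin_ext scaler_sumr -big_split /=.
by apply: eq_bigr => x _; rewrite !ffunE scalerDl scalerA.
Qed.
HB.instance Definition _ (V : lmodType k) (f : G -> V) :=
  GRing.isLinear.Build k kG V _ (lin_ext f) (lin_ext_is_linear f).

Lemma lin_extE (V : lmodType k) (f : G -> V) tau : lin_ext f (gelt tau) = f tau.
Proof.
rewrite /lin_ext (bigD1 tau) //= ffunE eqxx scale1r big1 ?addr0 // => x ne.
by rewrite ffunE (negPf ne) scale0r.
Qed.

Lemma galg_sumE (r : kG) : r = \sum_tau r tau *: gelt tau.
Proof.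
apply/ffunP => x; rewrite sum_ffunE (bigD1 x) //= big1 ?addr0.
  by rewrite !ffunE eqxx [_ *: _]mulr1.
by move=> y ne; rewrite !ffunE eq_sym (negPf ne) [_ *: _]mulr0.
Qed.

Lemma galg_ind (P : kG -> Prop) :
  P 0 -> (forall r s, P r -> P s -> P (r + s)) ->
  (forall a tau, P (a *: gelt tau)) -> forall r, P r.
Proof. by move=> P0 PD Pg r; rewrite (galg_sumE r); elim/big_ind: _. Qed.

Fact galg_mulE r s : galg_mul r s =
  \sum_tau r tau *: lin_ext (fun rho => gelt (tau * rho)%g) s.
Proof. by []. Qed.

Fact galg_mulDl : left_distributive galg_mul +%R.
Proof. by move=> r s u; rewrite /galg_mul linearD. Qed.

Fact galg_mulDr : right_distributive galg_mul +%R.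
Proof.
move=> r s u; rewrite !galg_mulE -big_split; apply: eq_bigr => x _ /=.
by rewrite linearD scalerDr.
Qed.

Fact galg_scalAl a r s : a *: galg_mul r s = galg_mul (a *: r) s.
Proof. by rewrite /galg_mul linearZ. Qed.

Fact galg_scalAr a r s : a *: galg_mul r s = galg_mul r (a *: s).
Proof.
rewrite !galg_mulE scaler_sumr; apply: eq_bigr => x _ /=.
by rewrite [in RHS]linearZ /= !scalerA mulrC.
Qed.


Fact galg_mulgelt tau rho : galg_mul (gelt tau) (gelt rho) = gelt (tau * rho)%g.
Proof. by rewrite /galg_mul !lin_extE. Qed.

Fact galg_mulZgelt a b tau rho :
  galg_mul (a *: gelt tau) (b *: gelt rho) = (a * b) *: gelt (tau * rho)%g.
Proof. by rewrite -galg_scalAl -galg_scalAr galg_mulgelt scalerA. Qed.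

Fact galg_mul0l s : galg_mul 0 s = 0.
Proof. by rewrite /galg_mul linear0. Qed.

Fact galg_mul0r r : galg_mul r 0 = 0.
Proof. by rewrite galg_mulE big1 // => x _; rewrite linear0 scaler0. Qed.

Fact galg_mulA : associative galg_mul.
Proof.
move=> r s u; elim/galg_ind: r => [|r r' Hr Hr'|a x]; rewrite ?galg_mul0l //.
  by rewrite !galg_mulDl Hr Hr'.
elim/galg_ind: s => [|s s' Hs Hs'|b y]; rewrite ?(galg_mul0l, galg_mul0r) //.
  by rewrite !(galg_mulDl, galg_mulDr) Hs Hs'.
elim/galg_ind: u => [|u u' Hu Hu'|c z]; rewrite ?galg_mul0r //.
  by rewrite !galg_mulDr Hu Hu'.
by rewrite !galg_mulZgelt mulgA mulrA.
Qed.

Fact galg_mul1l : left_id (gelt 1%g) galg_mul.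
Proof.
move=> r; elim/galg_ind: r => [|r s Hr Hs|a x]; first exact: galg_mul0r.
  by rewrite galg_mulDr Hr Hs.
by rewrite -[gelt 1%g]scale1r galg_mulZgelt mul1g mul1r.
Qed.

Fact galg_mul1r : right_id (gelt 1%g) galg_mul.
Proof.
move=> r; elim/galg_ind: r => [|r s Hr Hs|a x]; first exact: galg_mul0l.
  by rewrite galg_mulDl Hr Hs.
by rewrite -[gelt 1%g]scale1r galg_mulZgelt mulg1 mulr1.
Qed.

Fact galg_1_neq0 : gelt 1%g != 0.
Proof.
by apply/eqP => /ffunP/(_ 1%g); rewrite !ffunE eqxx; apply/eqP/oner_neq0.
Qed.

HB.instance Definition _ := GRing.Zmodule_isNzRing.Build kG
  galg_mulA galg_mul1l galg_mul1r galg_mulDl galg_mulDr galg_1_neq0.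
HB.instance Definition _ := GRing.Lmodule_isLalgebra.Build k kG galg_scalAl.
HB.instance Definition _ := GRing.Lalgebra_isAlgebra.Build k kG galg_scalAr.

Lemma gelt1 : gelt 1%g = 1. Proof. by []. Qed.
Lemma galg_mulZE a b tau rho :
  (a *: gelt tau) * (b *: gelt rho) = (a * b) *: gelt (tau * rho)%g.
Proof. exact: galg_mulZgelt. Qed.
Lemma geltM tau rho : gelt (tau * rho)%g = gelt tau * gelt rho.
Proof. by rewrite -galg_mulgelt. Qed.

Definition galg_comp (tau : G) (r : kG) : Prop := exists x : k, r = x *: gelt tau.

End GroupAlgebra.

(* Homomorphisms G -> k^*; nonvanishing is what makes the values units. *)
Record mulchar (k : fieldType) (G : finGroupType) := MulChar {
  mulchar_fun :> G -> k;
  mulchar_neq0 : forall tau, mulchar_fun tau != 0;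
  mulcharM : forall tau rho,
    mulchar_fun (tau * rho)%g = mulchar_fun tau * mulchar_fun rho
}.

Lemma mulchar1 k G (chi : mulchar k G) : chi 1%g = 1.
Proof.
by apply: (mulfI (mulchar_neq0 chi 1%g)); rewrite -mulcharM mulg1 mulr1.
Qed.

Section TrivialChar.
Variables (k : fieldType) (G : finGroupType).
Fact trivchar_neq0 (tau : G) : (fun _ => 1 : k) tau != 0.
Proof. exact: oner_neq0. Qed.
Fact trivcharM (tau rho : G) :
  (fun _ => 1 : k) (tau * rho)%g = (fun _ => 1 : k) tau * (fun _ => 1 : k) rho.
Proof. by rewrite mulr1. Qed.
Definition trivchar : mulchar k G := MulChar trivchar_neq0 trivcharM.
End TrivialChar.

Section Cohomology.
Variables (k : fieldType) (G : finGroupType) (chi : mulchar k G).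

Definition cocycle : {pred {ffun G -> k^o}} := fun c =>
  [forall tau, forall rho, c (tau * rho)%g == c tau + chi tau * c rho].

Fact cocycleP (c : {ffun G -> k^o}) :
  reflect (forall tau rho, c (tau * rho)%g = c tau + chi tau * c rho)
          (c \in cocycle).
Proof.
apply: (iffP forallP) => [H tau rho|H tau]; first exact/eqP/(forallP (H tau)).
by apply/forallP => rho; rewrite H.
Qed.

Fact cocycle_submod : submod_closed cocycle.
Proof.
split=> [|a c d /cocycleP Hc /cocycleP Hd]; apply/cocycleP => tau rho.
  by rewrite !ffunE mulr0 addr0.
rewrite !ffunE Hc Hd /= /GRing.scale /= !mulrDr mulrCA -!addrA; congr (_ + _).
by rewrite addrCA.
Qed.
HB.instance Definition _ :=
  GRing.isSubmodClosed.Build k {ffun G -> k^o} cocycle cocycle_submod.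

Record Z1 := MkZ1 { Z1val : {ffun G -> k^o}; Z1valP : Z1val \in cocycle }.
HB.instance Definition _ := [isSub for Z1val].
HB.instance Definition _ := [Choice of Z1 by <:].
HB.instance Definition _ := [SubChoice_isSubLmodule of Z1 by <:].

Definition Z1fun (c : Z1) (tau : G) : k := Z1val c tau.
Coercion Z1fun : Z1 >-> Funclass.

Lemma Z1E (c : Z1) tau rho : c (tau * rho)%g = c tau + chi tau * c rho.
Proof. exact: (elimT (cocycleP _) (Z1valP c)). Qed.

Definition B1 : {pred Z1} := fun c =>
  `[< exists x : k, forall tau, c tau = x * (chi tau - 1) >].

Fact B1_submod : submod_closed B1.
Proof.
split=> [|a c d /asboolP[x Hx] /asboolP[y Hy]]; apply/asboolP.
  by exists 0 => tau; rewrite mul0r /Z1fun ffunE.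
by exists (a * x + y) => tau; rewrite /Z1fun !ffunE -!/(Z1fun _ _) Hx Hy mulrDl -mulrA.
Qed.
HB.instance Definition _ := GRing.isSubmodClosed.Build k Z1 B1 B1_submod.

Definition H1 := Quotient.quot B1.
HB.instance Definition _ := GRing.Zmodule.on H1.
HB.instance Definition _ := EqQuotient.on H1.

Definition cohclass (c : Z1) : H1 := \pi c.

Lemma cohclass_eq0 (c : Z1) : (cohclass c == 0) = (c \in B1).
Proof. by rewrite -[c in RHS]subr0 Quotient.idealrBE [\pi 0]raddf0. Qed.

End Cohomology.

Record sigma_der (R : nzRingType) (sigma : R -> R) := SigmaDer {
  sigma_der_fun :> {additive R -> R};
  sigma_derM : forall r s,
    sigma_der_fun (r * s) = sigma_der_fun r * s + sigma r * sigma_der_fun s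
}.

(* [ore delta] is R[t; sigma, delta].  The underlying free left R-module is
   that of {poly R}, with 'X^n standing for t^n; [ore_tact] is left
   multiplication by t, i.e. sum_i r_i t^i |->
   sum_i (sigma r_i) t^(i+1) + sum_i (delta r_i) t^i. *)
Definition ore (R : nzRingType) (sigma : {rmorphism R -> R})
  (delta : sigma_der sigma) := {poly R}.

Section OreExtension.
Variables (R : nzRingType) (sigma : {rmorphism R -> R}).
Variable delta : sigma_der sigma.
Local Notation A := (ore delta).

HB.instance Definition _ := GRing.Lmodule.on A.

Definition ore_coef (a : A) (n : nat) : R := (a : {poly R})`_n.
Definition ore_t : A := ('X : {poly R}).
Definition ore_one : A := (1 : {poly R}).

Definition ore_tact (a : A) : A :=
  map_poly sigma (a : {poly R}) * 'X + map_poly delta (a : {poly R}).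

Definition ore_mul (a b : A) : A :=
  \sum_(i < size (a : {poly R})) ore_coef a i *: iter i ore_tact b.

Fact ore_tact_is_additive : zmod_morphism ore_tact.
Proof.
by move=> a b; rewrite /ore_tact !raddfB /= mulrBl opprD addrACA.
Qed.
HB.instance Definition _ :=
  GRing.isZmodMorphism.Build A A ore_tact ore_tact_is_additive.

Fact ore_tactZ r a : ore_tact (r *: a) = sigma r *: ore_tact a + delta r *: a.
Proof.
rewrite /ore_tact; apply/polyP => i.
rewrite !(coefD, coefZ, coefMX, coef_map) /= sigma_derM rmorphM /= mulrDr.
by case: eqP => _; rewrite ?mulr0 ?add0r -?addrA; [rewrite addrC | congr (_ + _); rewrite addrC].
Qed.

Fact ore_mul_wide n a b : (size (a : {poly R}) <= n)%N ->
  ore_mul a b = \sum_(i < n) ore_coef a i *: iter i ore_tact b.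
Proof.
move=> le; rewrite /ore_mul (big_ord_widen n (fun i => ore_coef a i *: iter i ore_tact b) le).
rewrite big_mkcond /=; apply: eq_bigr => i _; case: ltnP => // ge.
by rewrite /ore_coef nth_default // scale0r.
Qed.

Fact ore_mulDl : left_distributive ore_mul +%R.
Proof.
move=> a b d; pose n := maxn (size (a : {poly R})) (size (b : {poly R})).
rewrite (@ore_mul_wide n (a + b)) ?size_polyD // (@ore_mul_wide n a) ?leq_maxl //.
rewrite (@ore_mul_wide n b) ?leq_maxr // -big_split /=; apply: eq_bigr => i _.
by rewrite /ore_coef coefD scalerDl.
Qed.

Fact iter_tactD n : {morph iter n ore_tact : a b / a + b}.
Proof. by elim: n => [|n IH] a b; rewrite ?iterS ?IH ?raddfD. Qed.

Fact ore_mulDr : right_distributive ore_mul +%R.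
Proof.
move=> a b d; rewrite /ore_mul -big_split /=; apply: eq_bigr => i _.
by rewrite iter_tactD scalerDr.
Qed.

Fact ore_mulZl r a b : r *: ore_mul a b = ore_mul (r *: a) b.
Proof.
rewrite (@ore_mul_wide (size (a : {poly R})) (r *: a)) ?size_scale_leq //.
rewrite /ore_mul scaler_sumr; apply: eq_bigr => i _.
by rewrite /ore_coef coefZ scalerA.
Qed.

Fact ore_mul1l : left_id ore_one ore_mul.
Proof.
by move=> a; rewrite /ore_mul size_poly1 big_ord1 /ore_coef coef1 scale1r.
Qed.

Fact ore_tact_Xn n : ore_tact ('X^n : {poly R}) = ('X^(n.+1) : {poly R}).
Proof.
rewrite /ore_tact; apply/polyP => i.
have d1 : delta 1 = 0.
  have := sigma_derM delta 1 1; rewrite !mulr1 rmorph1 mul1r => H.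
  by apply: (addrI (delta 1)); rewrite addr0 -H.
rewrite coefD coefMX !coef_map !coefXn /=.
have -> : delta (i == n)%:R = 0 by case: eqP => _; rewrite ?d1 ?raddf0.
by case: i => [|i] /=; rewrite addr0 // rmorph_nat eqSS.
Qed.

Fact iter_tact1 n : iter n ore_tact ore_one = ('X^n : {poly R}).
Proof. by elim: n => [|n IH] /=; rewrite ?expr0 // IH ore_tact_Xn. Qed.

Fact ore_mul1r : right_id ore_one ore_mul.
Proof.
move=> a; rewrite /ore_mul [RHS](_ : _ = \poly_(i < size (a : {poly R})) (a : {poly R})`_i); last by rewrite coefK.
by rewrite poly_def; apply: eq_bigr => i _; rewrite iter_tact1.
Qed.

Fact ore_mul_tactl a b : ore_mul (ore_tact a) b = ore_tact (ore_mul a b).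
Proof.
set n := size (a : {poly R}).
have sz : (size (ore_tact a : {poly R}) <= n.+1)%N.
  rewrite /ore_tact; apply: leq_trans (size_polyD _ _) _; rewrite geq_max.
  apply/andP; split; last exact: leq_trans (size_poly _ _) (leqnSn _).
  have [->|nz] := eqVneq (map_poly sigma (a : {poly R})) 0; first by rewrite mul0r size_poly0.
  by rewrite size_mulX // ltnS size_poly.
rewrite (ore_mul_wide _ sz) /ore_mul raddf_sum -/n.
rewrite [RHS](eq_bigr _ (fun i _ => ore_tactZ _ _)).
rewrite big_split /=.
under eq_bigr do rewrite /ore_coef coefD scalerDl.
rewrite big_split /=; congr (_ + _).
  rewrite big_ord_recl coefMX /= scale0r add0r; apply: eq_bigr => i _.
  by rewrite coefMX coef_map.
rewrite big_ord_recr /= coef_map nth_default // raddf0 scale0r addr0.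
by apply: eq_bigr => i _; rewrite coef_map.
Qed.

Fact ore_mul_suml n (F : 'I_n -> A) b :
  ore_mul (\sum_i F i) b = \sum_i ore_mul (F i) b.
Proof.
have m0 : ore_mul 0 b = 0 by rewrite /ore_mul size_poly0 big_ord0.
exact: (big_morph (ore_mul^~ b) (fun x y => ore_mulDl x y b) m0).
Qed.

Fact ore_mulA : associative ore_mul.
Proof.
move=> a b d; rewrite {2}/ore_mul ore_mul_suml {1}/ore_mul; apply: eq_bigr => i _.
rewrite -ore_mulZl; congr (_ *: _).
by elim: {1 2}(i : nat) => //= n ->; rewrite ore_mul_tactl.
Qed.

Fact ore_1_neq0 : ore_one != 0.
Proof. exact: oner_neq0. Qed.

HB.instance Definition _ := GRing.Zmodule_isNzRing.Build A
  ore_mulA ore_mul1l ore_mul1r ore_mulDl ore_mulDr ore_1_neq0.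
HB.instance Definition _ := GRing.Lmodule_isLalgebra.Build R A ore_mulZl.

Lemma ore_tM (a : A) : ore_t * a = ore_tact a.
Proof.
rewrite [LHS](_ : _ = ore_mul ore_t a) // /ore_mul size_polyX.
by rewrite !big_ord_recl big_ord0 /ore_coef !coefX scale0r scale1r add0r addr0.
Qed.

Lemma ore_comm (r : R) : ore_t * r%:A = sigma r *: ore_t + (delta r)%:A :> A.
Proof.
rewrite ore_tM ore_tactZ; congr (_ *: _ + _).
by rewrite -[1]/(iter 0 ore_tact ore_one) -[ore_tact _]/(iter 1 ore_tact ore_one) iter_tact1.
Qed.

Lemma ore_tX n : ore_t ^+ n = ('X^n : {poly R}) :> A.
Proof.
elim: n => [|n IH]; first by rewrite !expr0.
by rewrite exprS IH ore_tM ore_tact_Xn.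
Qed.

Lemma ore_sumE (a : A) :
  a = \sum_(i < size (a : {poly R})) ore_coef a i *: ore_t ^+ i.
Proof.
rewrite -[LHS]mulr1 [LHS](_ : _ = ore_mul a ore_one) // /ore_mul.
by apply: eq_bigr => i _; rewrite iter_tact1 ore_tX.
Qed.

End OreExtension.

Section GradedIdeals.
Variable S : nzRingType.

Definition two_sided_ideal (I : S -> Prop) : Prop :=
  [/\ I 0, (forall a b, I a -> I b -> I (a + b))
    & forall r a, I a -> I (r * a) /\ I (a * r)].

Definition ideal_gen (X : S -> Prop) (a : S) : Prop :=
  forall I, two_sided_ideal I -> (forall x, X x -> I x) -> I a.

Variables (D : Type) (comp : D -> S -> Prop).

Definition homogeneous (a : S) : Prop := exists alpha, comp alpha a.

Definition graded_ideal (I : S -> Prop) : Prop :=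
  two_sided_ideal I /\
  exists X : S -> Prop,
    (forall x, X x -> homogeneous x) /\ (forall a, I a <-> ideal_gen X a).

Definition gr_simple : Prop :=
  forall I, graded_ideal I ->
    (forall a, I a <-> a = 0) \/ (forall a, I a).

Definition left_ideal_gen (x : S) (a : S) : Prop := exists b, a = b * x.

End GradedIdeals.

Section OreOverGroupAlgebra.
Variables (k : fieldType) (G : finGroupType) (gamma : G) (chi : mulchar k G).
Local Notation kG := (galg k G).

Definition gsigma : kG -> kG :=
  lin_ext (fun tau => chi tau *: gelt k (gamma * tau * gamma^-1)%g).

HB.instance Definition _ := GRing.Linear.on gsigma.

Lemma gsigmaE tau :
  gsigma (gelt k tau) = chi tau *: gelt k (gamma * tau * gamma^-1)%g.
Proof. exact: lin_extE. Qed.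

Fact gsigmaZE a tau :
  gsigma (a *: gelt k tau) =
  (a * chi tau) *: gelt k (gamma * tau * gamma^-1)%g.
Proof. by rewrite linearZ /= gsigmaE scalerA. Qed.

Fact gsigma_monoid_morphism : monoid_morphism gsigma.
Proof.
split=> [|r s]; first by rewrite -gelt1 gsigmaE mulchar1 scale1r mulg1 mulgV.
elim/galg_ind: r => [|r r' Hr Hr'|a x]; first by rewrite mul0r linear0 mul0r.
by rewrite mulrDl !linearD /= mulrDl Hr Hr'.
elim/galg_ind: s => [|s s' Hs Hs'|b y]; first by rewrite mulr0 linear0 mulr0.
  by rewrite mulrDr !linearD /= mulrDr Hs Hs'.
rewrite galg_mulZE !gsigmaZE galg_mulZE mulcharM mulrACA.
by congr (_ *: gelt k _); rewrite !mulgA mulgKV.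
Qed.
HB.instance Definition _ :=
  GRing.isMonoidMorphism.Build kG kG gsigma gsigma_monoid_morphism.

Lemma gsigma_bij : bijective gsigma.
Proof.
pose f : kG -> kG :=
  lin_ext (fun tau => (chi tau)^-1 *: gelt k (gamma^-1 * tau * gamma)%g).
have chiJ (x y : G) : chi (x * y * x^-1)%g = chi y.
  rewrite !mulcharM mulrC mulrA -mulcharM mulVg mulchar1 mul1r //.
have fE a x : f (a *: gelt k x) =
    (a * (chi x)^-1) *: gelt k (gamma^-1 * x * gamma)%g.
  by rewrite /f linearZ /= lin_extE scalerA.
have chiJ' x : chi (gamma^-1 * x * gamma)%g = chi x.
  by rewrite -{2}[gamma]invgK chiJ.
exists f => r; elim/galg_ind: r => [|r s Hr Hs|a x].
- by rewrite /f !linear0.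
- by rewrite /f !linearD /= -/f Hr Hs.
- rewrite gsigmaZE fE chiJ mulfK ?mulchar_neq0 //.
  by rewrite !mulgA mulVg mul1g mulgKV.
- by rewrite /f !linear0.
- by rewrite /f !linearD /= -/f Hr Hs.
rewrite fE gsigmaZE chiJ' mulfVK ?mulchar_neq0 //.
by rewrite !mulgA mulgV mul1g mulgK.
Qed.

Variable c : Z1 chi.

Definition gdelta_fun : kG -> kG :=
  lin_ext (fun tau => c tau *: gelt k (gamma * tau)%g).
HB.instance Definition _ := GRing.Linear.on gdelta_fun.

Lemma gdeltaE tau : gdelta_fun (gelt k tau) = c tau *: gelt k (gamma * tau)%g.
Proof. exact: lin_extE. Qed.

Fact gdeltaZE a tau :
  gdelta_fun (a *: gelt k tau) = (a * c tau) *: gelt k (gamma * tau)%g.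
Proof. by rewrite linearZ /= gdeltaE scalerA. Qed.

Fact gdeltaM r s :
  gdelta_fun (r * s) = gdelta_fun r * s + gsigma r * gdelta_fun s.
Proof.
elim/galg_ind: r => [|r r' Hr Hr'|a x].
- by rewrite !(mul0r, linear0) add0r.
- by rewrite mulrDl !linearD /= !mulrDl Hr Hr' addrACA.
elim/galg_ind: s => [|s s' Hs Hs'|b y].
- by rewrite !(mulr0, linear0) add0r.
- by rewrite mulrDr !linearD /= !mulrDr Hs Hs' addrACA.
rewrite galg_mulZE !gdeltaZE gsigmaZE !galg_mulZE Z1E !mulgA mulgKV.
rewrite -scalerDl; congr (_ *: _).
by rewrite mulrDr [a * b * c x]mulrAC [a * b * _]mulrACA.
Qed.

Definition gdelta : sigma_der gsigma := @SigmaDer kG gsigma gdelta_fun gdeltaM.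

Definition oreA : lalgType kG := ore gdelta.

(* Membership in the direct sum over n of (kG)_(alpha gamma^-n) t^n. *)
Definition oreA_comp (alpha : G) (a : oreA) : Prop :=
  forall n, galg_comp (alpha * gamma ^- n)%g (@ore_coef _ _ gdelta a n).

Definition oreA_t : oreA := ore_t gdelta.

End OreOverGroupAlgebra.

(* Main.v *)
Require Import Defs.
From HB Require Import structures.
From mathcomp Require Import all_boot all_algebra all_fingroup.
From mathcomp Require Import cyclic.
Import GRing.Theory.
Local Open Scope ring_scope.

(** Put s = gamma^-1 t, a homogeneous element whose degree is the identity of G. The commutation rule
of t with G becomes s tau = tau (chi(tau) s + c(tau)), so s commutes with k, and
tau acts on polynomials in s by the affine substitution
[twist tau] : X |-> chi(tau) X + c(tau). The cocycle identity says exactly that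
these substitutions compose as the elements of G do ([twist_comp]), and a
polynomial P that all of them fix gives a central element P(s) of A, again
homogeneous of that degree ([ore_ev_central], [ore_ev_comp1]). Then A P(s) is a
graded two-sided ideal.

If P(0) = 0, this ideal lies in A s = A t, whose elements have zero constant
coefficient, so it is proper; and P |-> P(s) is injective because right
multiplication by t shifts coefficients, so it is nonzero when P is. Hence
everything reduces to finding a nonzero invariant polynomial that vanishes at 0
([ore_ev_graded_ideal]).

When G is finite, the product of all the [twist tau] is invariant, since a
substitution permutes its factors, and the factor of tau = 1 is X. For G cyclic
of order p, chi = 1 and c(g^i) = i, the substitutions are X |-> X + i, and they
fix X^p - X by the additivity of the Frobenius map. The class [c] is nonzero
because coboundaries of the trivial character vanish while c(g) = 1. *)

(** * Right multiplication by t, and principal central ideals *)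

Section OreShift.
Variables (R : nzRingType) (sigma : {rmorphism R -> R}) (delta : sigma_der sigma).

(** In contrast with left multiplication, there is no twisting here: t is added
to the right end of each r t^i. *)
Lemma ore_mulr_t (a : ore delta) :
  a * ore_t delta = ((a : {poly R}) * 'X : {poly R}).
Proof.
rewrite [in LHS](ore_sumE a) mulr_suml -[in RHS](coefK (a : {poly R})) poly_def.
rewrite mulr_suml; apply: eq_bigr => i _.
by rewrite -scalerAl -exprSr ore_tX -scalerAl -exprSr.
Qed.

End OreShift.

Lemma central_graded_ideal (D : Type) (S : nzRingType) (comp : D -> S -> Prop) (z : S) :
  homogeneous comp z -> (forall a, a * z = z * a) ->
  graded_ideal comp (left_ideal_gen z).
Proof.
move=> homz zC.
have idJ : two_sided_ideal (left_ideal_gen z).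
  split=> [|_ _ [a ->] [b ->]|r _ [a ->]].
  - by exists 0; rewrite mul0r.
  - by exists (a + b); rewrite mulrDl.
  - by split; [exists (r * a); rewrite mulrA | exists (a * r); rewrite -!mulrA zC].
split=> //; exists (eq z); split=> [_ <- //|a]; split=> [[b ->] I idI Iz | Ia].
  by case: idI => _ _ /(_ b z (Iz z erefl)) [].
by apply: Ia => // _ <-; exists 1; rewrite mul1r.
Qed.

Lemma galg_compD (k : fieldType) (G : finGroupType) (tau : G) (r r' : galg k G) :
  galg_comp tau r -> galg_comp tau r' -> galg_comp tau (r + r').
Proof. by move=> [x ->] [y ->]; exists (x + y); rewrite scalerDl. Qed.

(** * The subalgebra k[s] of A *)

Section DegreeOneVariable.
Variables (k : fieldType) (G : finGroupType) (gamma : G) (chi : mulchar k G).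
Variable c : Z1 chi.
Local Notation kG := (galg k G).
Local Notation A := (oreA gamma c).
Local Notation t := (oreA_t gamma c).

Definition ore_s : A := (gelt k (gamma^-1)%g)%:A * t.
Local Notation s := ore_s.

(** A is only an algebra over kG, which is not central, so the embedding of k
goes through kG. *)
Definition ore_scalar : {rmorphism k -> A} := in_alg A \o in_alg kG.

Lemma cocycle1 : c 1%g = 0.
Proof.
have := Z1E c 1%g 1%g; rewrite mulg1 mulchar1 mul1r => H.
by apply: (addrI (c 1%g)); rewrite addr0 -H.
Qed.

(** The factor gamma^-1 in s cancels the gamma that sigma and delta_c both put
in front of tau, and the gamma^-1 that sigma leaves behind tau turns t back
into s; only an affine substitution remains. *)
Lemma ore_s_gelt tau :
  s * (gelt k tau)%:A =
  (gelt k tau)%:A * (ore_scalar (chi tau) * s + ore_scalar (c tau)).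
Proof.
rewrite /s /ore_scalar /= -mulrA [t * _]ore_comm /= gsigmaE gdeltaE.
rewrite !mulr_algl !scalerDr !scalerA -!scalerAr !mulr1 -!scalerAl -!geltM.
by rewrite !mulgA mulVg mul1g.
Qed.

(** sigma fixes k because chi(1) = 1, and delta_c kills k because c(1) = 0. *)
Lemma ore_scalar_comm : commr_rmorph ore_scalar s.
Proof.
move=> a; rewrite /GRing.comm /s /ore_scalar /= -mulrA [t * _]ore_comm /=.
rewrite -gelt1 gsigmaZE gdeltaZE.
rewrite mulchar1 cocycle1 mulr1 mulr0 mulg1 mulgV gelt1 scale0r scale0r addr0.
by rewrite !mulr_algl !scalerA -scalerAr -scalerAl mulr1 mul1r.
Qed.

Definition ore_ev : {rmorphism {poly k} -> A} := horner_morph ore_scalar_comm.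

Lemma ore_evC a : ore_ev a%:P = ore_scalar a.
Proof. exact: horner_morphC. Qed.

Lemma ore_evX : ore_ev 'X = s.
Proof. exact: horner_morphX. Qed.

Lemma ore_scalar_gelt a tau :
  ore_scalar a * (gelt k tau)%:A = (gelt k tau)%:A * ore_scalar a.
Proof.
by rewrite /ore_scalar /= !mulr_algl !scalerA -scalerAr -scalerAl mulr1 mul1r.
Qed.

Definition twist (tau : G) : {poly k} := chi tau *: 'X + (c tau)%:P.

Lemma ore_ev_twist tau :
  ore_ev (twist tau) = ore_scalar (chi tau) * s + ore_scalar (c tau).
Proof. by rewrite /twist -mul_polyC rmorphD rmorphM /= !ore_evC ore_evX. Qed.

(** The rule for s, extended to all of k[s]: conjugation by tau acts on k[s] as
a ring homomorphism, hence as a substitution. *)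
Lemma ore_ev_gelt (P : {poly k}) tau :
  ore_ev P * (gelt k tau)%:A = (gelt k tau)%:A * ore_ev (P \Po twist tau).
Proof.
elim/poly_ind: P => [|P a IH]; first by rewrite comp_poly0 rmorph0 mul0r mulr0.
rewrite comp_polyD comp_polyM comp_polyX comp_polyC !rmorphD !rmorphM /=.
rewrite mulrDl mulrDr !ore_evC ore_scalar_gelt; congr (_ + _).
by rewrite ore_evX -mulrA ore_s_gelt -ore_ev_twist mulrA IH mulrA.
Qed.

Lemma ore_tE : t = (gelt k gamma)%:A * s.
Proof. by rewrite /s mulrA mulr_algl scalerA -geltM mulgV gelt1 scale1r mul1r. Qed.

(** kG and s generate A; an invariant P(s) commutes with kG by [ore_ev_gelt], and
with s as a polynomial in s. *)
Lemma ore_ev_central (P : {poly k}) :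
  (forall tau, P \Po twist tau = P) -> forall a : A, a * ore_ev P = ore_ev P * a.
Proof.
move=> invP a.
have cg (r : kG) : r%:A * ore_ev P = ore_ev P * r%:A.
  rewrite (galg_sumE r) scaler_suml mulr_suml mulr_sumr; apply: eq_bigr => tau _.
  have -> : (r tau *: gelt k tau : kG)%:A =
            ore_scalar (r tau) * (gelt k tau)%:A :> A.
    by rewrite /ore_scalar /= mulr_algl scalerA -scalerAl mul1r.
  rewrite mulrA -ore_evC -rmorphM [P * _]mulrC rmorphM /= -!mulrA ore_ev_gelt.
  by rewrite invP.
have cs : s * ore_ev P = ore_ev P * s by rewrite -ore_evX -!rmorphM mulrC.
have ct : t * ore_ev P = ore_ev P * t.
  by rewrite ore_tE -mulrA cs !mulrA cg.
rewrite (ore_sumE a) mulr_suml mulr_sumr; apply: eq_bigr => i _.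
rewrite -mulr_algl mulrA -cg -!mulrA; congr (_ * _).
by apply/commr_sym/commrX/commr_sym.
Qed.

Lemma ore_coef_mul_s (a : A) n :
  ore_coef (a * s) n =
  if n is m.+1 then ore_coef (a * (gelt k gamma^-1)%:A : A) m else 0.
Proof.
rewrite /s mulrA ore_mulr_t /ore_coef coefMX.
by case: n.
Qed.

(** If P vanishes at 0 then P(s) lies in A s = A t. *)
Lemma ore_ev_coef0 (P : {poly k}) (b : A) :
  root P 0 -> ore_coef (b * ore_ev P) 0 = 0.
Proof.
case/factor_theorem => Q ->; rewrite subr0 rmorphM /= ore_evX mulrA.
exact: ore_coef_mul_s.
Qed.

(** The constant coefficient of Q(s) s + a is a, and right multiplication by s
is injective, being a shift after multiplication by a unit of kG; so the
coefficients of P can be read off P(s) one at a time. *)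
Lemma ore_ev_eq0 (P : {poly k}) : ore_ev P = 0 -> P = 0.
Proof.
elim/poly_ind: P => [//|P a IH]; rewrite rmorphD rmorphM /= ore_evC ore_evX => E.
have a0 : a = 0.
  have : ore_coef (ore_ev P * s + ore_scalar a) 0 = 0 by rewrite E /ore_coef coef0.
  rewrite /ore_coef coefD -!/(ore_coef _ _) ore_coef_mul_s add0r.
  rewrite /ore_scalar /ore_coef coefZ coef1 mulr1 => /ffunP/(_ 1%g).
  by rewrite !ffunE eqxx [_ *: _]mulr1.
(* Cancel the right factor t, then the unit gamma^-1. *)
move: E; rewrite a0 rmorph0 !addr0 => E.
have {}E : ore_ev P * (gelt k gamma^-1)%:A = 0.
  apply/polyP => n; rewrite [RHS]coef0 -[LHS]/(ore_coef _ n).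
  by rewrite -(ore_coef_mul_s _ n.+1) E /ore_coef coef0.
rewrite IH ?mul0r // -[ore_ev P]mulr1.
rewrite -[1](_ : (gelt k gamma^-1)%:A * (gelt k gamma)%:A = _).
  by rewrite mulrA E mul0r.
by rewrite mulr_algl scalerA -geltM mulVg gelt1 scale1r.
Qed.

(** Both parts of t r t^n, namely sigma(r) t^(n+1) and delta_c(r) t^n, have the
degree of r t^n multiplied on the left by gamma, and gamma^-1 brings it back. *)
Lemma ore_comp1_s (a : A) : oreA_comp (c:=c) 1%g a -> oreA_comp (c:=c) 1%g (s * a).
Proof.
move=> Ha n; rewrite /s -mulrA mulr_algl /oreA_t ore_tM /ore_coef coefZ coefD.
rewrite mulrDr; apply: galg_compD.
  case: n => [|n]; rewrite coefMX /=; first by exists 0; rewrite mulr0 scale0r.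
  rewrite coef_map /= -/(ore_coef a n); have [x ->] := Ha n.
  exists (x * chi (1 * gamma ^- n)%g); rewrite gsigmaZE -scalerAr -geltM.
  by congr (_ *: gelt k _); rewrite !mul1g -mulgA mulKg -invMg -expgS.
rewrite coef_map /= -/(ore_coef a n); have [x ->] := Ha n.
exists (x * c (1 * gamma ^- n)%g); rewrite gdeltaZE -scalerAr -geltM.
by rewrite mulKg.
Qed.

Lemma ore_ev_comp1 (P : {poly k}) : oreA_comp (c:=c) 1%g (ore_ev P).
Proof.
elim/poly_ind: P => [|P a IH].
  by move=> n; exists 0; rewrite rmorph0 /ore_coef coef0 scale0r.
rewrite [P * _]mulrC rmorphD rmorphM /= ore_evX ore_evC => n.
rewrite /ore_coef coefD; apply: galg_compD; first exact: ore_comp1_s.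
rewrite /ore_scalar /= coefZ coef1; case: n => [|n].
  by exists a; rewrite mulr1 expg0 invg1 mulg1 gelt1.
by exists 0; rewrite mulr0 scale0r.
Qed.

(** * Graded ideals from invariant polynomials *)

(** Centrality makes the left ideal two-sided, [ore_ev_eq0] makes it nonzero, and
the vanishing of P at 0 keeps 1 out of it. *)
Lemma ore_ev_graded_ideal (P : {poly k}) :
    P != 0 -> root P 0 -> (forall tau, P \Po twist tau = P) ->
  let J := left_ideal_gen (ore_ev P) in
  [/\ graded_ideal (@oreA_comp k G gamma _ c) J,
      (exists a : A, J a /\ a <> 0) & (exists a : A, ~ J a)].
Proof.
move=> nzP rP invP J; split.
- apply: central_graded_ideal; last exact: ore_ev_central.
  by exists 1%g; apply: ore_ev_comp1.
- exists (ore_ev P); split; first by exists 1; rewrite mul1r.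
  by move/ore_ev_eq0/eqP; rewrite (negPf nzP).
exists 1 => -[b E]; have := ore_ev_coef0 _ b rP.
by rewrite -E /ore_coef coef1 => /eqP; rewrite oner_eq0.
Qed.

(** This is the cocycle identity, together with the multiplicativity of chi. *)
Lemma twist_comp rho tau : twist rho \Po twist tau = twist (rho * tau)%g.
Proof.
rewrite /twist mulcharM Z1E comp_polyD comp_polyZ comp_polyX comp_polyC.
rewrite scalerDr scalerA -addrA -[chi rho *: _%:P]mul_polyC -polyCM -polyCD.
by rewrite [c rho + _]addrC.
Qed.

Lemma twist1 : twist 1%g = 'X.
Proof. by rewrite /twist mulchar1 cocycle1 scale1r addr0. Qed.

Lemma twist_neq0 tau : twist tau != 0.
Proof.
apply/eqP => /(congr1 (fun P : {poly k} => P`_1)) /eqP.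
by rewrite coefD coefZ coefX coefC coef0 mulr1 addr0 (negPf (mulchar_neq0 chi tau)).
Qed.

(** The norm of X under the affine action of G on k[X]. *)
Definition orbit_poly : {poly k} := \prod_tau twist tau.

Lemma orbit_poly_inv tau : orbit_poly \Po twist tau = orbit_poly.
Proof.
rewrite /orbit_poly rmorph_prod /= [RHS](reindex_inj (mulIg tau)).
by apply: eq_bigr => rho _; rewrite twist_comp.
Qed.

Lemma not_gr_simple_oreA : ~ gr_simple (@oreA_comp k G gamma chi c).
Proof.
move=> simpleA.
have nz : orbit_poly != 0 by apply/prodf_neq0 => tau _; exact: twist_neq0.
have r0 : root orbit_poly 0.
  by rewrite /orbit_poly (bigD1 1%g) //= twist1 rootM rootX eqxx.
have [grJ [a [Ja nza]] [b nJb]] := ore_ev_graded_ideal _ nz r0 orbit_poly_inv.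
by case: (simpleA _ grJ) => J; [move/J: Ja | case/nJb: (J b)].
Qed.

End DegreeOneVariable.

(** * The cyclic group of order p in characteristic p *)

Section CyclicOrderP.
Variables (k : fieldType) (p : nat).
Hypothesis charp : p \in [pchar k].

(** (X + i)^p = X^p + i^p and i^p = i in characteristic p, so both terms are
shifted by i. *)
Lemma artin_schreier_inv (i : nat) :
  ('X^p - 'X : {poly k}) \Po ('X + i%:R) = 'X^p - 'X.
Proof.
have charP : p \in [pchar {poly k}] by rewrite pchar_poly.
rewrite rmorphB rmorphXn /= comp_polyX -(pFrobenius_autE charP).
rewrite pFrobenius_autD_comm; last exact: mulrC.
by rewrite pFrobenius_aut_nat pFrobenius_autE opprD addrACA subrr addr0.
Qed.

Lemma artin_schreier_neq0 : 'X^p - 'X != 0 :> {poly k}.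
Proof.
have p_gt1 : (1 < p)%N by apply: prime_gt1; exact: pcharf_prime charp.
apply/eqP => /(congr1 (fun P : {poly k} => P`_p)) /eqP.
by rewrite coefB coefXn coefX eqxx coef0 gtn_eqF // subr0 oner_eq0.
Qed.

Variables (G : finGroupType) (g : G).
Hypotheses (hG : [set: G] = <[g]>%g) (hg : #[g]%g = p).

(** Stated as a sigma type so that it also provides a choice of logarithm. *)
Lemma generator_pow (tau : G) : {i | tau = (g ^+ i)%g}.
Proof.
have /cyclePmin[i _ ->] : tau \in <[g]>%g by rewrite -hG inE.
by exists i.
Qed.

(** The discrete logarithm to the base g is defined modulo p, hence well defined
in k, and it is additive. *)
Lemma standard_cocycle :
  exists c : Z1 (trivchar k G), forall i : nat, c (g ^+ i)%g = i%:R.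
Proof.
pose log tau : nat := sval (generator_pow tau).
have logE i : (log (g ^+ i)%g)%:R = i%:R :> k.
  have /esym/eqP := svalP (generator_pow (g ^+ i)%g).
  rewrite -/(log _) eq_expg_mod_order hg => /eqP E.
  by rewrite -(GRing.natr_mod_pchar charp) E GRing.natr_mod_pchar.
pose c0 : {ffun G -> k^o} := [ffun tau => (log tau)%:R].
have c0P : c0 \in cocycle (trivchar k G).
  apply/cocycleP => tau rho; rewrite !ffunE /= mul1r.
  have [[i ->] [j ->]] := (generator_pow tau, generator_pow rho).
  by rewrite -expgD !logE natrD.
by exists (MkZ1 c0P) => i; rewrite /Z1fun /= ffunE logE.
Qed.

Lemma standard_cohclass_neq0 (c : Z1 (trivchar k G)) :
  (forall i : nat, c (g ^+ i)%g = i%:R) -> cohclass c != 0.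
Proof.
move=> cE; rewrite cohclass_eq0; apply/negP => /boolp.asboolP[x /(_ g)].
by rewrite -{1}[g]expg1 cE subrr mulr0 => /eqP; rewrite oner_eq0.
Qed.

End CyclicOrderP.

Theorem corollary3p21 :
  (forall (k : fieldType) (G : finGroupType) (gamma : G) (chi : mulchar k G)
          (c : Z1 chi),
     ~ gr_simple (@oreA_comp k G gamma chi c))
  /\
  (forall (k : fieldType) (p : nat) (hp : p \in [pchar k])
          (G : finGroupType) (g gamma : G)
          (hG : [set: G] = <[g]>%g) (hg : #[g]%g = p),
     (exists c : Z1 (trivchar k G), forall i : nat, c (g ^+ i)%g = i%:R)
     /\
     (forall c : Z1 (trivchar k G), (forall i : nat, c (g ^+ i)%g = i%:R) ->
        let A := oreA gamma c in
        let s : A := (gelt k (gamma^-1)%g)%:A * oreA_t gamma c in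
        let J := left_ideal_gen (s ^+ p - s) in
        cohclass c != 0 /\
        [/\ graded_ideal (@oreA_comp k G gamma _ c) J,
            (exists a : A, J a /\ a <> 0)
          & (exists a : A, ~ J a)])).
Proof.
split=> [k G gamma chi c|k p hp G g gamma hG hg].
  exact: not_gr_simple_oreA.
split=> [|c cE A s J]; first exact: standard_cocycle hp _ _ hG hg.
split; first exact: standard_cohclass_neq0 cE.
have sE : s ^+ p - s = @ore_ev k G gamma _ c ('X^p - 'X).
  by rewrite rmorphB rmorphXn /= ore_evX.
rewrite /J sE; apply: ore_ev_graded_ideal.
- exact: artin_schreier_neq0.
- have p_gt0 : (0 < p)%N by apply: prime_gt0; exact: pcharf_prime hp.
  by rewrite rootE !hornerE expr0n gtn_eqF // subrr.
move=> tau; have [i ->] := generator_pow _ _ hG tau.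
by rewrite /twist /= scale1r cE polyC_natr artin_schreier_inv.
Qed.
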